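(* Let $f(u,u_x)$ and $g(u,u_x)$ be given functions, $C^0$ in $u$ and $C^1$ in $u_x$. The nonlinear dispersive wave equation $$m_t+f(u,u_x)m+(g(u,u_x)m)_x=0,\qquad m=u-u_{xx},$$ possesses dynamical peaked waves $u(x,t)=A(t)e^{-|x-X(t)|}$ with a non-zero acceleration $\ddot X(t)$ if and only if the amplitude $A(t)$ is time-dependent and the nonlinearity $g(u,u_x)$ satisfies $$\int_{-a}^{a}\big(g^+(a,y)-a\,g^+_u(a,y)\big)\,dy\neq a\,g^+(a,a)\quad\text{for some } a\in\mathbb{R},$$ where $g^+(u,u_x)=\tfrac12(g(u,u_x)+g(u,-u_x))$ and $g^+_u$ is the partial derivative of $g^+$ with respect to its first argument. This inequality is equivalent to the condition that the term $g_0(u)$ in the representation $$g(u,u_x)=g^-(u,u_x)+\int_{u}^{u_x}\tilde g^-(u,y)\,dy+u_x\tilde g^-(u,u_x)+g_0(u)$$ is non-constant.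
   Context: Dynamical peaked waves are the single-peakon weak solutions $u(x,t)=A(t)e^{-|x-X(t)|}$, with amplitude $A(t)$ and position $X(t)$, of the given wave equation. Their dynamics is given by $\dot A=\tfrac12[F(u,u_x)]_X$, $\dot X=-\tfrac12[G(u,u_x)]_X/A$, where $F=\int f\,du_x$ and $G=\int g\,du_x$ are antiderivatives with respect to $u_x$, and $[\cdot]_X$ denotes the jump at the discontinuity $x=X(t)$. In the representation of $g$: $g^-(u,u_x)=\tfrac12(g(u,u_x)-g(u,-u_x))$ is the part of $g$ that is odd in $u_x$. Let $G^-(u,u_x)=\tfrac12(G(u,u_x)-G(u,-u_x))$ be the odd part of $G$, and write $G^-=u_x\tilde G^+$ with $\tilde G^+$ even in $u_x$; then $\tilde g^-=\partial\tilde G^+/\partial u_x$ (odd in $u_x$), and $g_0(u)$ is the function of $u$ in $\tilde G^+(u,u_x)=\int_u^{u_x}\tilde g^-(u,y)\,dy+g_0(u)$, that is, $g_0(u)=G^-(u,u)/u$.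
   Formalization: The right side is corrected to 2a g^+(a,a); g^+ is assumed differentiable in u with g^+_u jointly continuous; a must be a value of the time-dependent amplitude A(t), or, for arbitrary real a, every interval of amplitudes must be met by a wave with time-dependent amplitude. *)

(* Defs.v *)
(* Stdlib real numbers with Coquelicot.  A nonlinearity h(u, u_x) is a function
   h : R -> R -> R whose first argument is u and whose second argument is u_x. *)
From Stdlib Require Import Reals.
From Coquelicot Require Import Coquelicot.
Open Scope R_scope.

Definition C0_C1 (h : R -> R -> R) : Prop :=
  (forall u v, continuous (fun w => h w v) u) /\
  (forall u v, ex_derive (h u) v) /\
  (forall u v, continuous (Derive (h u)) v).

Definition even_part (h : R -> R -> R) (u v : R) : R := (h u v + h u (- v)) / 2.
Definition odd_part  (h : R -> R -> R) (u v : R) : R := (h u v - h u (- v)) / 2.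

Definition d_u (h : R -> R -> R) (u v : R) : R := Derive (fun w => h w v) u.

Definition C1_in_u (h : R -> R -> R) : Prop :=
  (forall u v, ex_derive (fun w => h w v) u) /\
  (forall u v, continuity_2d_pt (d_u h) u v).

(* The antiderivative in u_x normalised to vanish at u_x = 0.  Any other one
   differs by a function of u alone, which drops out of jumps across a peak and
   of odd parts. *)
Definition antideriv (h : R -> R -> R) (u v : R) : R := RInt (h u) 0 v.

Definition peakon (A X : R -> R) (x t : R) : R := A t * exp (- Rabs (x - X t)).

Definition is_jump (h : R -> R) (x0 j : R) : Prop :=
  exists l r : R,
    filterlim h (at_left x0) (locally l) /\
    filterlim h (at_right x0) (locally r) /\
    j = r - l.

(* [H(u,u_x)]_X at time t for the peakon u. *)
Definition is_peak_jump (H : R -> R -> R) (A X : R -> R) (t j : R) : Prop :=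
  is_jump (fun x => H (peakon A X x t) (Derive (fun z => peakon A X z t) x))
          (X t) j.

Definition in_time (t0 t1 : Rbar) (t : R) : Prop := Rbar_lt t0 t /\ Rbar_lt t t1.

(* A peaked wave existing on the (possibly unbounded) open time interval
   (t0, t1), possibly with negative amplitude. *)
Definition peaked_wave (f g : R -> R -> R) (t0 t1 : Rbar) (A X : R -> R) : Prop :=
  Rbar_lt t0 t1 /\
  forall t, in_time t0 t1 t ->
    A t <> 0 /\
    exists jF jG : R,
      is_peak_jump (antideriv f) A X t jF /\
      is_peak_jump (antideriv g) A X t jG /\
      is_derive A t (1 / 2 * jF) /\
      is_derive X t (- (1 / 2) * jG / A t).

Definition time_dependent (t0 t1 : Rbar) (A : R -> R) : Prop :=
  exists t t', in_time t0 t1 t /\ in_time t0 t1 t' /\ A t <> A t'.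

Definition nonzero_acceleration (t0 t1 : Rbar) (X : R -> R) : Prop :=
  exists t c, in_time t0 t1 t /\ is_derive (Derive X) t c /\ c <> 0.

Definition possesses_accelerating_peaked_wave (f g : R -> R -> R) : Prop :=
  exists (t0 t1 : Rbar) (A X : R -> R),
    peaked_wave f g t0 t1 A X /\ nonzero_acceleration t0 t1 X.

(* The speed of a peak of amplitude a is the integral of g^+(a, y) over [-a, a]
   divided by 2 a, so its derivative in a vanishes iff the two sides below
   agree.  The factor 2 is forced: for g constant both sides must agree. *)
Definition accel_condition (g : R -> R -> R) (a : R) : Prop :=
  RInt (fun y => even_part g a y - a * d_u (even_part g) a y) (- a) a
  <> 2 * a * even_part g a a.

(* The function G~^+ with G^- = u_x G~^+, extended by continuity to u_x = 0. *)
Definition G_tilde (g : R -> R -> R) (u v : R) : R :=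
  if Req_EM_T v 0 then Derive (odd_part (antideriv g) u) 0
  else odd_part (antideriv g) u v / v.

Definition g_tilde (g : R -> R -> R) (u v : R) : R := Derive (G_tilde g u) v.

Definition g_zero (g : R -> R -> R) (u : R) : R := G_tilde g u u.

(* Main.v *)
(** Across a peak of amplitude [A] the jump of [G] is [- 2 G^-(A, A)], so the peak
    moves with speed [c(A) = g_zero g A], the mean of [g^+(A, s A)] over [0 <= s <= 1].
    Hence the acceleration is [A' c'(A)], and [accel_condition g a] says exactly that
    [a <> 0] and [c'(a) <> 0].  If a wave with time-dependent amplitude never
    accelerates, then [c o A] is constant although [A] takes values different from and
    arbitrarily close to each of its values [a], so that [c'(a) = 0].
    The representation of [g] is the identity [g^+ = d/dv (v G~^+)], where
    [G~^+(u, v)] is the mean of [g^+(u, s v)] over [0 <= s <= 1], which is [C^1] in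
    [v] also at [v = 0]. *)
Require Import Defs.
From Stdlib Require Import Reals Lra Classical.
From Coquelicot Require Import Coquelicot.
Open Scope R_scope.

(** * Continuity in two variables and integrals depending on a parameter *)

Lemma continuous_along (h : R -> R -> R) (p q : R -> R) (x : R) :
  continuity_2d_pt h (p x) (q x) -> continuous p x -> continuous q x ->
  continuous (fun y => h (p y) (q y)) x.
Proof.
intros Hh Hp Hq.
apply (continuous_comp_2 p q h x Hp Hq).
now apply (proj1 (continuity_2d_pt_filterlim h (p x) (q x))).
Qed.

Lemma continuity_2d_pt_comp (h p q : R -> R -> R) (x y : R) :
  continuity_2d_pt h (p x y) (q x y) ->
  continuity_2d_pt p x y -> continuity_2d_pt q x y ->
  continuity_2d_pt (fun u v => h (p u v) (q u v)) x y.
Proof.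
rewrite !continuity_2d_pt_filterlim.
intros Hh Hp Hq.
exact (continuous_comp_2 (fun z : R * R => p (fst z) (snd z))
         (fun z => q (fst z) (snd z)) h (x, y) Hp Hq Hh).
Qed.

Lemma continuous_slice (h : R -> R -> R) (u v : R) :
  continuity_2d_pt h u v -> continuous (h u) v.
Proof.
intros Hh.
apply (continuous_along h (fun _ => u) (fun y => y) v Hh).
- apply continuous_const.
- apply continuous_id.
Qed.

(** By compactness of [[a, b]], [h y] tends to [h x] uniformly in the integration variable, so the
    difference of the integrals is at most the length of the interval times a uniform bound. *)
Lemma continuous_RInt_param (h : R -> R -> R) (a b x : R) :
  a <= b ->
  (forall u v, continuity_2d_pt h u v) ->
  continuous (fun u => RInt (h u) a b) x.
Proof.
intros Hab Hh.
assert (Hex : forall u, ex_RInt (h u) a b).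
{ intros u. apply (ex_RInt_continuous (V := R_CompleteNormedModule)).
  intros z _. now apply continuous_slice. }
apply continuity_pt_filterlim, continuity_pt_locally.
intros eps.
(* The [+ 1] keeps the denominator positive when [a = b] and makes the final bound strictly less
   than [eps]. *)
assert (He : 0 < eps / (b - a + 1)).
{ apply Rdiv_lt_0_compat; [apply cond_pos | lra]. }
destruct (uniform_continuity_2d_1d' h a b x (fun z _ => Hh x z) (mkposreal _ He))
  as [d Hd].
exists d; intros y Hy.
change (Rabs (y - x) < d) in Hy.
replace (RInt (h y) a b - RInt (h x) a b) with (RInt (fun s => h y s - h x s) a b)
  by (apply (RInt_minus (V := R_CompleteNormedModule)); apply Hex).
apply Rle_lt_trans with ((b - a) * (eps / (b - a + 1))).
- apply abs_RInt_le_const; [exact Hab | | ].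
  + now apply (ex_RInt_minus (V := R_NormedModule)).
  + intros t Ht. apply Rlt_le, (Hd t x t y); try lra.
    * pose proof (cond_pos d); lra.
    * apply Rabs_def2 in Hy; lra.
    * rewrite Rminus_diag, Rabs_R0. apply cond_pos.
- pose proof (cond_pos eps).
  apply Rmult_lt_reg_r with (b - a + 1); [lra|].
  field_simplify; [nra | lra].
Qed.

(** The substitution [y = s * v], valid for every sign of [v] and for [v = 0]. It trades a moving
    bound for a fixed interval, so that dividing by [v] leaves a mean that still makes sense at
    [v = 0]. *)
Lemma RInt_scaled (k : R -> R) (v : R) :
  (forall x, continuous k x) ->
  RInt k 0 v = v * RInt (fun s => k (s * v)) 0 1.
Proof.
intros Hk.
assert (Hex : forall a b, ex_RInt k a b)
  by (intros; apply (ex_RInt_continuous (V := R_CompleteNormedModule)); auto).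
transitivity (RInt (fun s => scal v (k (v * s + 0))) 0 1).
- rewrite (RInt_comp_lin (V := R_CompleteNormedModule)) by apply Hex.
  f_equal; ring.
- rewrite (RInt_ext _ (fun s => scal v (k (s * v)))).
  + apply (RInt_scal (V := R_CompleteNormedModule)).
    apply (ex_RInt_continuous (V := R_CompleteNormedModule)). intros z _.
    apply (continuous_comp (fun s => s * v) k); [|apply Hk].
    apply (continuous_mult (fun s : R => s) (fun _ => v));
      [apply continuous_id | apply continuous_const].
  + intros s _. do 2 f_equal. ring.
Qed.

Lemma RInt_reflected (k : R -> R) (v : R) :
  (forall x, continuous k x) ->
  RInt k 0 (- v) = - RInt (fun y => k (- y)) 0 v.
Proof.
intros Hk.
assert (Hk' : forall x, continuous (fun y => k (- y)) x).
{ intros x. apply (continuous_comp Ropp k); [|apply Hk].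
  apply (continuous_opp (fun y : R => y)), continuous_id. }
rewrite (RInt_scaled k (- v)), (RInt_scaled _ v) by assumption.
rewrite Ropp_mult_distr_l. f_equal.
apply RInt_ext; intros s _. f_equal. ring.
Qed.

Lemma RInt_even (k : R -> R) (a : R) :
  (forall x, continuous k x) -> (forall x, k (- x) = k x) ->
  RInt k (- a) a = 2 * RInt k 0 a.
Proof.
intros Hk He.
assert (Hex : forall a b, ex_RInt k a b)
  by (intros; apply (ex_RInt_continuous (V := R_CompleteNormedModule)); auto).
rewrite <- (RInt_Chasles (V := R_CompleteNormedModule) k (- a) 0 a) by apply Hex.
rewrite <- (opp_RInt_swap (V := R_CompleteNormedModule)) by apply Hex.
rewrite RInt_reflected by assumption.
rewrite (RInt_ext (fun y => k (- y)) k) by (intros; apply He).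
unfold plus, opp; simpl. ring.
Qed.

Lemma ex_derive_continuous_R (k : R -> R) (x : R) : ex_derive k x -> continuous k x.
Proof. apply (ex_derive_continuous (V := R_NormedModule)). Qed.

(** * The even part of [g] in [u_x] and the odd part of its antiderivative *)

Lemma is_derive_even_part (g : R -> R -> R) (u v : R) :
  C0_C1 g ->
  is_derive (even_part g u) v ((Derive (g u) v - Derive (g u) (- v)) / 2).
Proof.
intros [_ [Hd _]]. unfold even_part.
pose proof (Hd u v) as H1. pose proof (Hd u (- v)) as H2.
apply Derive_correct in H1. apply Derive_correct in H2.
evar_last.
- apply (is_derive_ext (fun y => scal (/ 2) (plus (g u y) (g u (- y))))).
  { intros t. unfold scal, plus; simpl; unfold mult; simpl. field. }
  apply (is_derive_scal (fun y => plus (g u y) (g u (- y)))).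
  apply (is_derive_plus (V := R_NormedModule)); [exact H1|].
  apply (is_derive_comp (V := R_NormedModule) (g u) Ropp); [exact H2|].
  apply (is_derive_opp (V := R_NormedModule) (fun y : R => y)), is_derive_id.
- unfold scal, plus, opp, one; simpl; unfold mult; simpl. field.
Qed.

Lemma continuous_Derive_even_part (g : R -> R -> R) (u v : R) :
  C0_C1 g -> continuous (Derive (even_part g u)) v.
Proof.
intros Hg.
apply (continuous_ext (fun y => scal (/ 2) (minus (Derive (g u) y) (Derive (g u) (- y))))).
{ intros y. rewrite (is_derive_unique _ _ _ (is_derive_even_part g u y Hg)).
  unfold scal, minus, plus, opp; simpl; unfold mult; simpl. field. }
destruct Hg as [_ [_ Hc]].
apply (continuous_scal_r (V := R_NormedModule)).
apply (continuous_minus (V := R_NormedModule)); [apply Hc|].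
apply (continuous_comp Ropp); [|apply Hc].
apply (continuous_opp (V := R_NormedModule) (fun y : R => y)), continuous_id.
Qed.

Lemma continuous_even_part (g : R -> R -> R) (u v : R) :
  C0_C1 g -> continuous (even_part g u) v.
Proof.
intros Hg. apply ex_derive_continuous_R.
eexists. now apply is_derive_even_part.
Qed.

Lemma even_part_opp (g : R -> R -> R) (u v : R) :
  even_part g u (- v) = even_part g u v.
Proof. unfold even_part. rewrite Ropp_involutive. field. Qed.

(** Joint continuity comes from differentiability in the plane: a jointly continuous partial
    derivative in [u] together with a partial derivative in [u_x] at the point gives a total
    differential. *)
Lemma continuity_2d_even_part (g : R -> R -> R) (u v : R) :
  C0_C1 g -> C1_in_u (even_part g) -> continuity_2d_pt (even_part g) u v.
Proof.
intros Hg [Hd Hc].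
apply continuity_2d_pt_filterlim.
apply (filterdiff_continuous (K := R_AbsRing)
  (fun z : R * R => even_part g (fst z) (snd z)) (u, v)).
eexists.
apply (is_derive_filterdiff (even_part g) u v (d_u (even_part g))).
- apply filter_forall. intros [u' v']. apply Derive_correct, Hd.
- now apply is_derive_even_part.
- apply continuity_2d_pt_filterlim, Hc.
Qed.

(** Reflecting [y] to [- y] in the integral from 0 to [- v] changes its sign, so the difference in
    [odd_part] becomes a sum of integrals of [g u y] and [g u (- y)]. *)
Lemma odd_part_antideriv (g : R -> R -> R) (u v : R) :
  C0_C1 g -> odd_part (antideriv g) u v = RInt (even_part g u) 0 v.
Proof.
intros [_ [Hd _]].
assert (Hc : forall y, continuous (g u) y) by (intros; now apply ex_derive_continuous_R).
assert (Hc' : forall y, continuous (fun y => g u (- y)) y).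
{ intros y. apply (continuous_comp Ropp (g u)); [|apply Hc].
  apply (continuous_opp (V := R_NormedModule) (fun y : R => y)), continuous_id. }
assert (Hex : ex_RInt (g u) 0 v /\ ex_RInt (fun y => g u (- y)) 0 v)
  by (split; apply (ex_RInt_continuous (V := R_CompleteNormedModule)); auto).
destruct Hex as [Hex Hex'].
unfold odd_part, antideriv.
rewrite RInt_reflected by assumption.
rewrite (RInt_ext (even_part g u) (fun y => scal (/ 2) (plus (g u y) (g u (- y))))).
- rewrite (RInt_scal (V := R_CompleteNormedModule) (fun y => plus (g u y) (g u (- y)))).
  + rewrite (RInt_plus (V := R_CompleteNormedModule)) by assumption.
    unfold scal, plus; simpl; unfold mult; simpl. field.
  + now apply (ex_RInt_plus (V := R_NormedModule)).
- intros y _. unfold even_part, scal, plus; simpl; unfold mult; simpl. field.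
Qed.

(** * The function [G_tilde] as a mean, and the representation of [g] *)

Lemma G_tilde_mean (g : R -> R -> R) (u v : R) :
  C0_C1 g -> G_tilde g u v = RInt (fun s => even_part g u (s * v)) 0 1.
Proof.
intros Hg. unfold G_tilde.
assert (Hc : forall y, continuous (even_part g u) y)
  by (intros; now apply continuous_even_part).
(* Both branches of [G_tilde] give the same mean: at [v = 0] the derivative of the integral is its
   integrand at 0, which is the mean of a constant; elsewhere the scaling substitution cancels
   [v]. *)
destruct (Req_EM_T v 0) as [->|Hv].
- rewrite (Derive_ext _ (RInt (even_part g u) 0))
    by (intros; now apply odd_part_antideriv).
  rewrite Derive_RInt.
  + rewrite (RInt_ext _ (fun _ => even_part g u 0))
      by (intros; f_equal; ring).
    rewrite (RInt_const (V := R_CompleteNormedModule)).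
    unfold scal; simpl; unfold mult; simpl. ring.
  + apply filter_forall; intros y.
    apply (ex_RInt_continuous (V := R_CompleteNormedModule)); auto.
  + apply Hc.
- rewrite odd_part_antideriv, RInt_scaled by assumption. now field.
Qed.

Lemma is_derive_dilated (k : R -> R) (s v : R) :
  (forall x, ex_derive k x) ->
  is_derive (fun z => k (s * z)) v (s * Derive k (s * v)).
Proof.
intros Hk.
apply (is_derive_comp (V := R_NormedModule) k (fun z => s * z)).
- now apply Derive_correct.
- evar_last.
  + apply (is_derive_scal (fun z : R => z)), is_derive_id.
  + unfold one; simpl; ring.
Qed.

(** Differentiation under the integral sign; in the form of a mean over [[0, 1]] the point [v = 0]
    is not exceptional. *)
Lemma is_derive_G_tilde (g : R -> R -> R) (u v : R) :
  C0_C1 g ->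
  is_derive (G_tilde g u) v
    (RInt (fun s => s * Derive (even_part g u) (s * v)) 0 1).
Proof.
intros Hg.
assert (Hk : forall x, ex_derive (even_part g u) x)
  by (intros; eexists; now apply is_derive_even_part).
assert (HD : forall s z, Derive (fun z => even_part g u (s * z)) z
                       = s * Derive (even_part g u) (s * z))
  by (intros; now apply is_derive_unique, is_derive_dilated).
apply (is_derive_ext (fun z => RInt (fun s => even_part g u (s * z)) 0 1)).
{ intros; symmetry; now apply G_tilde_mean. }
rewrite (RInt_ext _ (fun s => Derive (fun z => even_part g u (s * z)) v))
  by (intros; symmetry; apply HD).
apply (is_derive_RInt_param (fun z s => even_part g u (s * z))).
- apply filter_forall; intros z s _. eexists; now apply is_derive_dilated.
- intros s _.
  apply (continuity_2d_pt_ext (fun z s => s * Derive (even_part g u) (s * z))).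
  { intros; symmetry; apply HD. }
  apply continuity_2d_pt_mult; [apply continuity_2d_pt_id2|].
  apply (continuity_1d_2d_pt_comp (Derive (even_part g u)) (fun z s => s * z)).
  + now apply continuity_pt_filterlim, continuous_Derive_even_part.
  + apply continuity_2d_pt_mult; [apply continuity_2d_pt_id2|apply continuity_2d_pt_id1].
- apply filter_forall; intros z.
  apply (ex_RInt_continuous (V := R_CompleteNormedModule)); intros s _.
  apply ex_derive_continuous_R.
  apply (ex_derive_ext (fun s => even_part g u (z * s))).
  + intros; f_equal; ring.
  + eexists; now apply is_derive_dilated.
Qed.

Lemma continuous_g_tilde (g : R -> R -> R) (u v : R) :
  C0_C1 g -> continuous (g_tilde g u) v.
Proof.
intros Hg.
apply (continuous_ext (fun v => RInt (fun s => s * Derive (even_part g u) (s * v)) 0 1)).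
{ intros z. symmetry. now apply is_derive_unique, is_derive_G_tilde. }
apply (continuous_RInt_param (fun v s => s * Derive (even_part g u) (s * v))); [lra|].
intros z s. apply continuity_2d_pt_mult; [apply continuity_2d_pt_id2|].
apply (continuity_1d_2d_pt_comp (Derive (even_part g u)) (fun z s => s * z)).
- now apply continuity_pt_filterlim, continuous_Derive_even_part.
- apply continuity_2d_pt_mult; [apply continuity_2d_pt_id2|apply continuity_2d_pt_id1].
Qed.

(** Two ways to differentiate the integral of [even_part g u] from 0 to [v]: the fundamental theorem
    gives the left side, the product rule applied to [v * G_tilde g u v] the right side. *)
Lemma even_part_G_tilde (g : R -> R -> R) (u v : R) :
  C0_C1 g -> even_part g u v = G_tilde g u v + v * g_tilde g u v.
Proof.
intros Hg.
assert (Hc : forall y, continuous (even_part g u) y)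
  by (intros; now apply continuous_even_part).
transitivity (Derive (RInt (even_part g u) 0) v).
- symmetry. apply Derive_RInt; [|apply Hc].
  apply filter_forall; intros y.
  apply (ex_RInt_continuous (V := R_CompleteNormedModule)); auto.
- rewrite (Derive_ext _ (fun y => y * G_tilde g u y)).
  + rewrite Derive_mult, Derive_id.
    * unfold g_tilde; ring.
    * apply ex_derive_id.
    * eexists; now apply is_derive_G_tilde.
  + intros y. now rewrite RInt_scaled, G_tilde_mean by assumption.
Qed.

(** The integral of [g_tilde] from [u] to [v] is [G_tilde g u v - G_tilde g u u], and the subtracted
    term is exactly [g_zero g u]. *)
Lemma g_representation (g : R -> R -> R) (u v : R) :
  C0_C1 g ->
  g u v = odd_part g u v + RInt (g_tilde g u) u v + v * g_tilde g u v + g_zero g u.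
Proof.
intros Hg.
unfold g_zero. unfold g_tilde at 1. rewrite RInt_Derive.
- transitivity (odd_part g u v + even_part g u v).
  + unfold odd_part, even_part; field.
  + rewrite even_part_G_tilde by assumption. ring.
- intros x _. eexists; now apply is_derive_G_tilde.
- intros x _. now apply continuous_g_tilde.
Qed.

(** * The peak speed [g_zero] and its derivative in the amplitude *)

Lemma continuity_2d_dilated (h : R -> R -> R) (a s : R) :
  (forall u v, continuity_2d_pt h u v) ->
  continuity_2d_pt (fun a s => h a (s * a)) a s.
Proof.
intros Hh.
apply (continuity_2d_pt_comp h (fun a _ => a) (fun a s => s * a)).
- apply Hh.
- apply continuity_2d_pt_id1.
- apply continuity_2d_pt_mult; [apply continuity_2d_pt_id2|apply continuity_2d_pt_id1].
Qed.

Lemma g_zero_mean (g : R -> R -> R) (a : R) :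
  C0_C1 g -> g_zero g a = RInt (fun s => even_part g a (s * a)) 0 1.
Proof. exact (G_tilde_mean g a a). Qed.

Lemma continuous_g_zero (g : R -> R -> R) (a : R) :
  C0_C1 g -> C1_in_u (even_part g) -> continuous (g_zero g) a.
Proof.
intros Hg Hu.
apply (continuous_ext (fun a => RInt (fun s => even_part g a (s * a)) 0 1)).
{ intros x. symmetry. now apply g_zero_mean. }
apply (continuous_RInt_param (fun a s => even_part g a (s * a))); [lra|].
intros; apply continuity_2d_dilated; intros; now apply continuity_2d_even_part.
Qed.

(** The quotient rule for [g_zero] written as the integral of [even_part g a] over [[0, a]] divided
    by [a], with the integral of the [u]-derivative rescaled to [[0, 1]]. Only [a <> 0] is
    meaningful. *)
Definition g_zero_slope (g : R -> R -> R) (a : R) : R :=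
  RInt (fun s => d_u (even_part g) a (s * a)) 0 1
  + (even_part g a a - g_zero g a) / a.

(** Differentiating the mean of [even_part g a (s * a)] directly would bring in the
    [u_x]-derivative, whose joint continuity is not assumed. The integral with moving upper bound
    [u] needs only the [u]-derivative and the value at the endpoint; division by [u] follows. *)
Lemma is_derive_g_zero (g : R -> R -> R) (a : R) :
  C0_C1 g -> C1_in_u (even_part g) -> a <> 0 ->
  is_derive (g_zero g) a (g_zero_slope g a).
Proof.
intros Hg Hu Ha.
assert (Hex : forall u b c, ex_RInt (even_part g u) b c).
{ intros. apply (ex_RInt_continuous (V := R_CompleteNormedModule)).
  intros; now apply continuous_even_part. }
assert (Hint : forall u, RInt (even_part g u) 0 u = u * g_zero g u).
{ intros u. rewrite g_zero_mean by assumption.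
  apply RInt_scaled. intros; now apply continuous_even_part. }
destruct Hu as [Hud Huc].
assert (HP : is_derive (fun u => RInt (even_part g u) 0 u) a
   (RInt (fun y => d_u (even_part g) a y) 0 a + even_part g a a * 1)).
{ apply (is_derive_RInt_param_bound_comp_aux3 (even_part g) 0 (fun u => u) a 1).
  - apply filter_forall; intros; apply Hex.
  - exists (mkposreal 1 Rlt_0_1). apply filter_forall; intros; apply Hex.
  - exact (is_derive_id (K := R_AbsRing) a).
  - exists (mkposreal 1 Rlt_0_1). apply filter_forall; intros; apply Hud.
  - intros; apply Huc.
  - exists (mkposreal 1 Rlt_0_1). intros; apply Huc.
  - now apply continuity_pt_filterlim, continuous_even_part. }
rewrite RInt_scaled in HP by (intros; now apply continuous_slice).
apply (is_derive_ext_loc (fun u => RInt (even_part g u) 0 u / u)).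
(* Points at distance less than [Rabs a] from [a] are nonzero, so the quotient equals [g_zero]
   there. *)
- assert (Hp : 0 < Rabs a) by now apply Rabs_pos_lt.
  exists (mkposreal _ Hp). intros y Hy.
  change (Rabs (y - a) < Rabs a) in Hy.
  assert (y <> 0).
  { intros ->. rewrite Rminus_0_l, Rabs_Ropp in Hy. lra. }
  rewrite Hint. change (y * g_zero g y / y = g_zero g y). now field.
- evar_last.
  + apply (is_derive_div _ (fun u : R => u)); [exact HP | apply is_derive_id | exact Ha].
  + unfold g_zero_slope. rewrite Hint. unfold one; simpl. now field.
Qed.

Lemma continuous_g_zero_slope (g : R -> R -> R) (a : R) :
  C0_C1 g -> C1_in_u (even_part g) -> a <> 0 -> continuous (g_zero_slope g) a.
Proof.
intros Hg Hu Ha. unfold g_zero_slope.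
apply (continuous_plus (V := R_NormedModule)).
- apply (continuous_RInt_param (fun a s => d_u (even_part g) a (s * a))); [lra|].
  intros; now apply continuity_2d_dilated, Hu.
- apply (continuous_mult (K := R_AbsRing)).
  + apply (continuous_minus (V := R_NormedModule)); [|now apply continuous_g_zero].
    apply (continuous_along (even_part g) (fun a => a) (fun a => a)).
    * now apply continuity_2d_even_part.
    * apply continuous_id.
    * apply continuous_id.
  + apply (continuous_Rinv_comp (fun a : R => a)); [apply continuous_id | exact Ha].
Qed.

(** Evenness halves the interval and scaling moves it to [[0, 1]]; the two sides of
    [accel_condition] then differ by [- (2 * a ^ 2)] times the slope. *)
Lemma accel_condition_iff (g : R -> R -> R) (a : R) :
  C0_C1 g -> C1_in_u (even_part g) ->
  accel_condition g a <-> a <> 0 /\ g_zero_slope g a <> 0.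
Proof.
intros Hg Hu. unfold accel_condition.
assert (Hc : forall y, continuous (even_part g a) y)
  by (intros; now apply continuous_even_part).
assert (Hc' : forall y, continuous (d_u (even_part g) a) y)
  by (intros; apply continuous_slice, Hu).
assert (Heq : RInt (fun y => even_part g a y - a * d_u (even_part g) a y) (- a) a
              - 2 * a * even_part g a a = - (2 * a ^ 2) * g_zero_slope g a).
{ rewrite RInt_even.
  - rewrite (RInt_ext _ (fun y => minus (even_part g a y) (scal a (d_u (even_part g) a y))))
      by reflexivity.
    assert (Hex : ex_RInt (even_part g a) 0 a /\ ex_RInt (d_u (even_part g) a) 0 a)
      by (split; apply (ex_RInt_continuous (V := R_CompleteNormedModule)); auto).
    destruct Hex as [Hex Hex'].
    rewrite (RInt_minus (V := R_CompleteNormedModule));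
      [| assumption | now apply (ex_RInt_scal (V := R_NormedModule))].
    rewrite (RInt_scal (V := R_CompleteNormedModule)) by assumption.
    rewrite !(RInt_scaled _ a) by assumption.
    rewrite <- g_zero_mean by assumption.
    unfold g_zero_slope, minus, plus, opp, scal; simpl; unfold mult; simpl.
    (* At [a = 0] both sides vanish, whatever value the division by 0 in the slope takes. *)
    destruct (Req_dec a 0) as [->|Ha]; [ring | now field].
  - intros y. apply (continuous_minus (V := R_NormedModule)); [apply Hc|].
    apply (continuous_scal_r (V := R_NormedModule)), Hc'.
  - intros y. rewrite even_part_opp. do 2 f_equal.
    apply Derive_ext. intros; apply even_part_opp. }
split.
- intros H. split; intros H0; apply H, Rminus_diag_uniq; rewrite Heq, H0; ring.
- intros [Ha Hs] H. apply Rminus_diag_eq in H. rewrite Heq in H.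
  apply Rmult_integral in H. destruct H as [H|H]; [|contradiction].
  apply Ha. nra.
Qed.

(** * The jump of the antiderivative across the peak *)

Lemma antideriv_jump (g : R -> R -> R) (w : R) :
  w <> 0 -> antideriv g w (- w) - antideriv g w w = - (2 * w * g_zero g w).
Proof.
intros Hw. unfold g_zero, G_tilde.
destruct (Req_EM_T w 0) as [|_]; [contradiction|].
unfold odd_part. now field.
Qed.

Lemma peakon_behind (A X : R -> R) (t e : R) :
  0 < e ->
  peakon A X (X t - e) t = A t * exp (- e) /\
  Derive (fun z => peakon A X z t) (X t - e) = A t * exp (- e).
Proof.
intros He.
assert (Hp : forall z, z < X t -> peakon A X z t = A t * exp (z - X t)).
{ intros z Hz. unfold peakon. rewrite Rabs_left by lra. do 2 f_equal. ring. }
split.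
- rewrite Hp by lra. do 2 f_equal. ring.
- apply is_derive_unique.
  apply (is_derive_ext_loc (fun z => A t * exp (z - X t))).
  + exists (mkposreal e He). intros z Hz.
    change (Rabs (z - (X t - e)) < e) in Hz. apply Rabs_def2 in Hz.
    symmetry. apply Hp. lra.
  + auto_derive; [easy|]. rewrite Rmult_1_l. do 2 f_equal. ring.
Qed.

Lemma peakon_ahead (A X : R -> R) (t e : R) :
  0 < e ->
  peakon A X (X t + e) t = A t * exp (- e) /\
  Derive (fun z => peakon A X z t) (X t + e) = - (A t * exp (- e)).
Proof.
intros He.
assert (Hp : forall z, X t < z -> peakon A X z t = A t * exp (- (z - X t))).
{ intros z Hz. unfold peakon. now rewrite Rabs_pos_eq by lra. }
split.
- rewrite Hp by lra. do 2 f_equal. ring.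
- apply is_derive_unique.
  apply (is_derive_ext_loc (fun z => A t * exp (- (z - X t)))).
  + exists (mkposreal e He). intros z Hz.
    change (Rabs (z - (X t + e)) < e) in Hz. apply Rabs_def2 in Hz.
    symmetry. apply Hp. lra.
  + auto_derive; [easy|].
    replace (- (X t + e + - X t)) with (- e) by ring. ring.
Qed.

Lemma filterlim_minus_at_left (x : R) :
  filterlim (fun e => x - e) (at_right 0) (at_left x).
Proof.
intros P [d Hd]. exists d. intros e He Hpos. apply Hd; [|lra].
change (Rabs (e - 0) < d) in He. change (Rabs (x - e - x) < d).
replace (x - e - x) with (- (e - 0)) by ring. now rewrite Rabs_Ropp.
Qed.

Lemma filterlim_plus_at_right (x : R) :
  filterlim (fun e => x + e) (at_right 0) (at_right x).
Proof.
intros P [d Hd]. exists d. intros e He Hpos. apply Hd; [|lra].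
change (Rabs (e - 0) < d) in He. change (Rabs (x + e - x) < d).
now replace (x + e - x) with (e - 0) by ring.
Qed.

(** Both one-sided limits are sampled at the same distance [e] from the crest. There [u] has the
    common value [w = A t * exp (- e)], while [u_x] is [w] behind and [- w] ahead, so the difference
    of the samples is given exactly by [antideriv_jump]. Continuity of [g_zero] then gives the limit
    as [e] tends to 0. *)
Lemma peak_jump_antideriv (g : R -> R -> R) (A X : R -> R) (t j : R) :
  C0_C1 g -> C1_in_u (even_part g) -> A t <> 0 ->
  is_peak_jump (antideriv g) A X t j -> j = - (2 * A t * g_zero g (A t)).
Proof.
intros Hg Hu HA [l [r [Hl [Hr ->]]]].
apply (filterlim_locally_unique (K := R_AbsRing) (V := R_NormedModule)
  (F := at_right 0) (fun e => - (2 * (A t * exp (- e)) * g_zero g (A t * exp (- e))))).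
- pose proof (filterlim_comp _ _ _ _ _ _ _ _ (filterlim_minus_at_left (X t)) Hl) as Hl'.
  pose proof (filterlim_comp _ _ _ _ _ _ _ _ (filterlim_plus_at_right (X t)) Hr) as Hr'.
  pose proof (filterlim_comp _ _ _ _ _ _ _ _ Hl' (filterlim_opp (V := R_NormedModule) l)) as Hl''.
  assert (Hd := filterlim_comp_2 _ _ _ Hr' Hl''
    (filterlim_plus (V := R_NormedModule) r (opp l))).
  revert Hd. apply filterlim_within_ext.
  intros e He. cbv beta.
  destruct (peakon_behind A X t e He) as [-> ->].
  destruct (peakon_ahead A X t e He) as [-> ->].
  apply antideriv_jump.
  apply Rmult_integral_contrapositive_currified; [exact HA|].
  apply Rgt_not_eq, exp_pos.
- apply (filterlim_filter_le_1 (F := locally 0)); [apply filter_le_within|].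
  assert (Hw : continuous (fun e => A t * exp (- e)) 0).
  { apply (ex_derive_continuous (V := R_NormedModule)). now auto_derive. }
  assert (Hk : continuous (fun w => - (2 * w * g_zero g w)) (A t * exp (- 0))).
  { apply (continuous_opp (V := R_NormedModule) (fun w : R => 2 * w * g_zero g w)).
    apply (continuous_mult (K := R_AbsRing)); [|now apply continuous_g_zero].
    apply (continuous_scal_r (V := R_NormedModule)), continuous_id. }
  pose proof (continuous_comp _ _ 0 Hw Hk) as H. unfold continuous in H.
  now rewrite Ropp_0, exp_0, Rmult_1_r in H.
Qed.

(** * Speed and acceleration of a peaked wave *)

Lemma in_time_locally (t0 t1 : Rbar) (t : R) :
  in_time t0 t1 t -> locally t (in_time t0 t1).
Proof.
intros [H0 H1]. apply filter_and.
- exact (open_Rbar_gt' t t0 H0).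
- exact (open_Rbar_lt' t t1 H1).
Qed.

Lemma in_time_between (t0 t1 : Rbar) (p q s : R) :
  in_time t0 t1 p -> in_time t0 t1 q -> p <= s <= q -> in_time t0 t1 s.
Proof.
intros [Hp _] [_ Hq] [Hps Hsq]. split.
- now apply (Rbar_lt_le_trans _ p).
- now apply (Rbar_le_lt_trans _ q).
Qed.

Lemma peaked_wave_dynamics (f g : R -> R -> R) (t0 t1 : Rbar) (A X : R -> R) (t : R) :
  C0_C1 g -> C1_in_u (even_part g) ->
  peaked_wave f g t0 t1 A X -> in_time t0 t1 t ->
  A t <> 0 /\ ex_derive A t /\ Derive X t = g_zero g (A t).
Proof.
intros Hg Hu [_ Hw] Ht.
destruct (Hw t Ht) as [HA [jF [jG [_ [HG [HdA HdX]]]]]].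
split; [exact HA|]. split; [eexists; exact HdA|].
apply is_derive_unique.
rewrite (peak_jump_antideriv g A X t jG Hg Hu HA HG) in HdX.
evar_last; [exact HdX|]. now field.
Qed.

(** The velocity agrees with [g_zero g (A s)] for all times [s] near [t], so the chain rule for the
    latter also gives the acceleration. *)
Lemma peaked_wave_acceleration (f g : R -> R -> R) (t0 t1 : Rbar) (A X : R -> R) (t : R) :
  C0_C1 g -> C1_in_u (even_part g) ->
  peaked_wave f g t0 t1 A X -> in_time t0 t1 t ->
  is_derive (Derive X) t (Derive A t * g_zero_slope g (A t)) /\
  is_derive (fun s => g_zero g (A s)) t (Derive A t * g_zero_slope g (A t)).
Proof.
intros Hg Hu Hw Ht.
destruct (peaked_wave_dynamics f g t0 t1 A X t Hg Hu Hw Ht) as [HA [HdA _]].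
assert (Hc : is_derive (fun s => g_zero g (A s)) t (Derive A t * g_zero_slope g (A t))).
{ apply (is_derive_comp (V := R_NormedModule) (g_zero g) A).
  - now apply is_derive_g_zero.
  - now apply Derive_correct. }
split; [|exact Hc].
revert Hc. apply is_derive_ext_loc.
apply (filter_imp (in_time t0 t1)); [|now apply in_time_locally].
intros s Hs. symmetry.
now apply (peaked_wave_dynamics f g t0 t1 A X s Hg Hu Hw Hs).
Qed.

(** * Isolated values and values attained nearby *)

Lemma is_derive_isolated_value (k : R -> R) (a l : R) :
  is_derive k a l -> l <> 0 ->
  exists d : posreal, forall w, w <> a -> Rabs (w - a) < d -> k w <> k a.
Proof.
intros Hk Hl. apply is_derive_Reals in Hk.
(* With tolerance [Rabs l] the difference quotient cannot be 0, as it would be if [k w = k a]. *)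
destruct (Hk (Rabs l) (Rabs_pos_lt l Hl)) as [d Hd].
exists d. intros w Hwa Hw Heq.
assert (Hh : w - a <> 0) by lra.
specialize (Hd (w - a) Hh Hw).
replace (a + (w - a)) with w in Hd by ring.
rewrite Heq, Rminus_diag in Hd. unfold Rdiv in Hd.
rewrite Rmult_0_l, Rminus_0_l, Rabs_Ropp in Hd. lra.
Qed.

Lemma intermediate_value (k : R -> R) (p q w : R) :
  (forall s, Rmin p q <= s <= Rmax p q -> continuous k s) ->
  k p < w < k q -> exists s, Rmin p q <= s <= Rmax p q /\ k s = w.
Proof.
intros Hk Hw.
destruct (Rtotal_order p q) as [Hpq|[->|Hpq]]; [|lra|].
- rewrite Rmin_left, Rmax_right in * by lra.
  destruct (Ranalysis5.IVT_interv (fun s => k s - w) p q) as [s [Hs Hs']]; try lra.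
  + intros s Hs. apply continuity_pt_filterlim.
    apply (continuous_minus (V := R_NormedModule) k (fun _ => w));
      [now apply Hk | apply continuous_const].
  + exists s. split; [exact Hs|lra].
(* On the interval from [q] to [p] the value [w] is crossed downwards, so the sign is flipped to fit
   a theorem that expects negative on the left and positive on the right. *)
- rewrite Rmin_right, Rmax_left in * by lra.
  destruct (Ranalysis5.IVT_interv (fun s => w - k s) q p) as [s [Hs Hs']]; try lra.
  + intros s Hs. apply continuity_pt_filterlim.
    apply (continuous_minus (V := R_NormedModule) (fun _ => w) k);
      [apply continuous_const | now apply Hk].
  + exists s. split; [exact Hs|lra].
Qed.

(** Either [k q] is already within [d] of [k p], or the intermediate value theorem supplies the
    value at distance [d / 2] on the side of [k q]. *)
Lemma near_value_attained (k : R -> R) (p q : R) (d : posreal) :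
  (forall s, Rmin p q <= s <= Rmax p q -> continuous k s) -> k q <> k p ->
  exists s, Rmin p q <= s <= Rmax p q /\ k s <> k p /\ Rabs (k s - k p) < d.
Proof.
intros Hk Hne.
pose proof (cond_pos d) as Hd.
destruct (Rle_or_lt d (Rabs (k q - k p))) as [Hle|Hlt].
- destruct (Rdichotomy _ _ Hne) as [Hlt|Hgt].
  + rewrite Rabs_left in Hle by lra.
    destruct (intermediate_value k q p (k p - d / 2)) as [s [Hs Hks]].
    * intros s. rewrite Rmin_comm, Rmax_comm. apply Hk.
    * lra.
    * exists s. rewrite Rmin_comm, Rmax_comm. split; [exact Hs|].
      rewrite Hks. split; [lra|]. apply Rabs_def1; lra.
  + rewrite Rabs_pos_eq in Hle by lra.
    destruct (intermediate_value k p q (k p + d / 2) Hk) as [s [Hs Hks]]; [lra|].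
    exists s. split; [exact Hs|].
    rewrite Hks. split; [lra|]. apply Rabs_def1; lra.
- exists q. split; [|now split].
  split; [apply Rmin_r|apply Rmax_r].
Qed.

(** * Acceleration, time-dependent amplitude and non-constant [g_zero] *)

Lemma accelerating_wave_condition (f g : R -> R -> R) (t0 t1 : Rbar) (A X : R -> R) :
  C0_C1 g -> C1_in_u (even_part g) ->
  peaked_wave f g t0 t1 A X -> nonzero_acceleration t0 t1 X ->
  time_dependent t0 t1 A /\
  exists a, (exists t, in_time t0 t1 t /\ A t = a) /\ accel_condition g a.
Proof.
intros Hg Hu Hw [t [c [Ht [Hc Hc0]]]].
destruct (peaked_wave_dynamics f g t0 t1 A X t Hg Hu Hw Ht) as [HA _].
destruct (peaked_wave_acceleration f g t0 t1 A X t Hg Hu Hw Ht) as [Hacc _].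
assert (Hceq : c = Derive A t * g_zero_slope g (A t)).
{ rewrite <- (is_derive_unique _ _ _ Hc). now apply is_derive_unique. }
rewrite Hceq in Hc0.
(* The nonzero product forces both factors to be nonzero: the first rules out a constant amplitude,
   the second gives the condition at [a = A t]. *)
split.
- apply NNPP. intros Hconst. apply Hc0.
  replace (Derive A t) with 0; [apply Rmult_0_l|]. symmetry.
  rewrite (Derive_ext_loc A (fun _ => A t)).
  + apply Derive_const.
  + apply (filter_imp (in_time t0 t1)); [|now apply in_time_locally].
    intros s Hs. apply NNPP. intros Hne. apply Hconst. now exists s, t.
- exists (A t). split; [now exists t|].
  apply accel_condition_iff; [assumption..|].
  split; [exact HA|]. intros H0. apply Hc0. rewrite H0. apply Rmult_0_r.
Qed.

(** The acceleration need not occur at [t] itself, where [Derive A t] may vanish; the time at which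
    it occurs is obtained by contradiction. *)
Lemma time_dependent_wave_accelerates (f g : R -> R -> R) (t0 t1 : Rbar) (A X : R -> R) (t : R) :
  C0_C1 g -> C1_in_u (even_part g) ->
  peaked_wave f g t0 t1 A X -> time_dependent t0 t1 A ->
  in_time t0 t1 t -> accel_condition g (A t) ->
  nonzero_acceleration t0 t1 X.
Proof.
intros Hg Hu Hw [p [q [Hp [Hq Hpq]]]] Ht Hacc.
apply NNPP. intros Hno.
apply accel_condition_iff in Hacc; [|assumption..].
destruct Hacc as [HA Hs].
assert (Hzero : forall s, in_time t0 t1 s -> is_derive (fun s => g_zero g (A s)) s 0).
{ intros s Hs'.
  destruct (peaked_wave_acceleration f g t0 t1 A X s Hg Hu Hw Hs') as [H1 H2].
  destruct (Req_dec (Derive A s * g_zero_slope g (A s)) 0) as [H0|H0].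
  - now rewrite H0 in H2.
  - exfalso. apply Hno. now exists s, (Derive A s * g_zero_slope g (A s)). }
assert (Hconst : forall s, in_time t0 t1 s -> g_zero g (A s) = g_zero g (A t)).
{ intros s Hs'. destruct (Rtotal_order s t) as [Hst|[->|Hst]]; [|easy|].
  - apply (eq_is_derive (fun s => g_zero g (A s))); [|exact Hst].
    intros r Hr. apply Hzero, (in_time_between t0 t1 s t); assumption.
  - symmetry. apply (eq_is_derive (fun s => g_zero g (A s))); [|exact Hst].
    intros r Hr. apply Hzero, (in_time_between t0 t1 t s); assumption. }
(* Since [A p] and [A q] differ, at least one of them differs from [A t]. *)
assert (Hq' : exists q, in_time t0 t1 q /\ A q <> A t).
{ destruct (Req_dec (A p) (A t)) as [He|He]; [|now exists p].
  exists q. split; [exact Hq|congruence]. }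
clear p q Hp Hq Hpq. destruct Hq' as [q [Hq Hqt]].
destruct (is_derive_isolated_value _ _ _ (is_derive_g_zero g (A t) Hg Hu HA) Hs)
  as [d Hd].
assert (Hin : forall s, Rmin t q <= s <= Rmax t q -> in_time t0 t1 s).
{ intros s. unfold Rmin, Rmax. destruct (Rle_dec t q) as [_|_].
  - now apply in_time_between.
  - now apply in_time_between. }
(* Between [t] and [q] the amplitude takes a value other than [A t] within the distance [d] where
   [g_zero g (A t)] is not repeated, against the constancy in [Hconst]. *)
destruct (near_value_attained A t q d) as [s [Hst [Hne Hlt]]]; [|exact Hqt|].
- intros s Hs'. apply ex_derive_continuous_R.
  now apply (peaked_wave_dynamics f g t0 t1 A X s Hg Hu Hw (Hin s Hs')).
- exact (Hd (A s) Hne Hlt (Hconst s (Hin s Hst))).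
Qed.

(** Continuity of the slope away from 0. Openness lets a wave whose amplitude only comes close to
    [a] stand in for one that attains it. *)
Lemma accel_condition_open (g : R -> R -> R) (a : R) :
  C0_C1 g -> C1_in_u (even_part g) -> accel_condition g a ->
  locally a (accel_condition g).
Proof.
intros Hg Hu Ha.
apply accel_condition_iff in Ha; [|assumption..]. destruct Ha as [Ha Hs].
apply (filter_imp (fun w => w <> 0 /\ g_zero_slope g w <> 0)).
{ intros w Hw. now apply accel_condition_iff. }
apply filter_and.
- exact (open_neq 0 a Ha).
- apply (continuous_g_zero_slope g a Hg Hu Ha (fun y => y <> 0)).
  now apply open_neq.
Qed.

Lemma accel_condition_g_zero (g : R -> R -> R) :
  C0_C1 g -> C1_in_u (even_part g) ->
  (exists a, accel_condition g a) <-> ~ (exists c, forall u, g_zero g u = c).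
Proof.
intros Hg Hu. split.
- intros [a Ha] [c Hc].
  apply accel_condition_iff in Ha; [|assumption..]. destruct Ha as [Ha Hs].
  apply Hs. rewrite <- (is_derive_unique _ _ _ (is_derive_g_zero g a Hg Hu Ha)).
  rewrite (Derive_ext _ (fun _ => c)) by exact Hc. apply Derive_const.
- intros Hnc. apply NNPP. intros Hno. apply Hnc. exists (g_zero g 0). intros u.
  (* The mean value theorem asks for the derivative only strictly between 0 and [u], where the slope
     formula applies; at 0 continuity is enough. *)
  destruct (MVT_gen (g_zero g) 0 u (fun _ => 0)) as [_ [_ H]].
  + intros x Hx.
    assert (Hx0 : x <> 0).
    { intros ->. revert Hx. unfold Rmin, Rmax. destruct (Rle_dec 0 u); lra. }
    evar_last; [now apply is_derive_g_zero|].
    apply NNPP. intros Hs. apply Hno. exists x. now apply accel_condition_iff.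
  + intros x _. now apply continuity_pt_filterlim, continuous_g_zero.
  + lra.
Qed.

(** The condition on [g] matters only at amplitudes that a wave attains, as the first equivalence
    records. The condition at an arbitrary [a] suffices once waves of time-dependent amplitude reach
    every interval; for [f = 0], for instance, all amplitudes are constant. *)
Theorem lemma2 :
  forall f g : R -> R -> R,
    C0_C1 f -> C0_C1 g -> C1_in_u (even_part g) ->
    (possesses_accelerating_peaked_wave f g <->
       exists (t0 t1 : Rbar) (A X : R -> R),
         peaked_wave f g t0 t1 A X /\
         time_dependent t0 t1 A /\
         exists a : R,
           (exists t, in_time t0 t1 t /\ A t = a) /\ accel_condition g a)
    /\
    ((forall lo hi : R, lo < hi ->
        exists (t0 t1 : Rbar) (A X : R -> R),
          peaked_wave f g t0 t1 A X /\ time_dependent t0 t1 A /\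
          exists t, in_time t0 t1 t /\ lo < A t < hi) ->
     (possesses_accelerating_peaked_wave f g <->
        exists a : R, accel_condition g a))
    /\
    (forall u v : R,
       g u v = odd_part g u v + RInt (g_tilde g u) u v
               + v * g_tilde g u v + g_zero g u)
    /\
    ((exists a : R, accel_condition g a) <->
       ~ (exists c : R, forall u : R, g_zero g u = c)).
Proof.
intros f g _ Hg Hu.
assert (Hiff : possesses_accelerating_peaked_wave f g <->
  exists (t0 t1 : Rbar) (A X : R -> R),
    peaked_wave f g t0 t1 A X /\ time_dependent t0 t1 A /\
    exists a : R,
      (exists t, in_time t0 t1 t /\ A t = a) /\ accel_condition g a).
{ split.
  - intros [t0 [t1 [A [X [Hw Ha]]]]]. exists t0, t1, A, X.
    split; [exact Hw|]. now apply (accelerating_wave_condition f g t0 t1 A X).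
  - intros [t0 [t1 [A [X [Hw [Htd [a [[t [Ht <-]] Ha]]]]]]]]. exists t0, t1, A, X.
    split; [exact Hw|]. now apply (time_dependent_wave_accelerates f g t0 t1 A X t). }
split; [exact Hiff|]. split; [|split].
- intros Hex. split.
  + intros Hp. apply Hiff in Hp.
    destruct Hp as [_ [_ [_ [_ [_ [_ [a [_ Ha]]]]]]]]. now exists a.
  + intros [a Ha].
    (* The radius [d] of this neighbourhood is the window of amplitudes for which a wave is
       requested. *)
    destruct (accel_condition_open g a Hg Hu Ha) as [d Hd].
    pose proof (cond_pos d).
    destruct (Hex (a - d) (a + d)) as [t0 [t1 [A [X [Hw [Htd [t [Ht HAt]]]]]]]]; [lra|].
    apply Hiff. exists t0, t1, A, X. split; [exact Hw|]. split; [exact Htd|].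
    exists (A t). split; [now exists t|].
    apply Hd. change (Rabs (A t - a) < d). apply Rabs_def1; lra.
- intros u v. now apply g_representation.
- now apply accel_condition_g_zero.
Qed.
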